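(* For every $n\in\mathbb{N}$, $n\geq 1$, there exist $a_1,\ldots,a_n\in\mathbb{C}\setminus\{0\}$ such that the harmonic polynomial \[ P_n(z,\bar z)=\sum_{k=1}^{\lfloor n/2\rfloor}a_{2k}z^{2k}+\sum_{k=1}^{\lceil n/2\rceil}a_{2k-1}\bar z^{\,2k-1} \] has exactly $n^2$ distinct zeros in $\mathbb{C}$.
   Context: A zero of $P_n$ is a point $z\in\mathbb{C}$ with $P_n(z,\bar z)=0$. *)

(* Defs.v *)
(* complex numbers as R[i] (mathcomp-real-closed) over a real
   field R : realType (the real numbers, up to isomorphism). *)
From mathcomp Require Import all_boot all_order all_algebra.
From mathcomp Require Import reals.
From mathcomp.real_closed Require Import complex.
Set Implicit Arguments. Unset Strict Implicit. Unset Printing Implicit Defensive.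
Import Order.TTheory GRing.Theory Num.Theory.
Local Open Scope ring_scope.
Local Open Scope complex_scope.

(* P_n(z, zbar) = sum_{k=1}^{floor(n/2)} a_{2k} z^{2k}
                + sum_{k=1}^{ceil(n/2)} a_{2k-1} zbar^{2k-1} ;
   floor(n/2) = n./2, ceil(n/2) = uphalf n; a is indexed by nat (only a_1..a_n used). *)
Definition Pn (R : realType) (n : nat) (a : nat -> R[i]) (z : R[i]) : R[i] :=
  \sum_(1 <= k < (n./2).+1) a (2 * k)%N * z ^+ (2 * k)
  + \sum_(1 <= k < (uphalf n).+1) a (2 * k).-1 * (z^*) ^+ (2 * k).-1.

(* Main.v *)
(* Take a_j = (-1)^j e^(j(j-1)/2) with e > 0 small and, for 1 <= k < n, look at
   z = e^-k w. After division by a common factor the terms of degree k and k+1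
   have coefficients 1 and -1 and all the others are O(e), so for even k the
   equation is a perturbation of w^k = conj(w)^(k+1), and for odd k of its
   conjugate. The nonzero solutions of the latter are the 2k+1 roots of
   w^(2k+1) = 1; they are nondegenerate, hence each persists by the contraction
   principle. Together with z = 0 this gives 1 + sum_(1 <= k < n) (2k+1) = n^2
   zeros of distinct sizes or arguments.

   Conversely, P_n(z, w) = 0 and its conjugate equation express z^n and w^n,
   w = conj(z), by lower powers of z and of w. Hence the n^2 monomials z^i w^j,
   i, j < n, span all polynomial functions on any finite set of zeros, which
   therefore has at most n^2 elements (Bezout's bound). *)
Require Import Defs.
From HB Require Import structures.
From mathcomp Require Import all_boot all_order all_algebra.
From mathcomp Require Import separable cyclotomic.
From mathcomp Require Import classical_sets functions interval_inference.
From mathcomp Require Import reals topology normedtype sequences.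
From mathcomp.real_closed Require Import complex.
From mathcomp Require Import ring lra zify.
Import Order.TTheory GRing.Theory Num.Theory.
Import numFieldNormedType.Exports ComplexField.Normc.
Local Open Scope ring_scope.
Local Open Scope complex_scope.

Set Implicit Arguments.
Unset Strict Implicit.

(** Makes R^2 a complete normed space, as the Banach fixed point theorem requires. *)
HB.instance Definition _ (R : realType) :=
  Uniform_isComplete.Build 'rV[R]_2 cauchy_cvg.

(** * Counting the common zeros of two polynomial relations *)

Section PointCount.
Variable K : fieldType.

(* Reducing by the two relations lowers the total degree, so the n^2 monomials
   z^i w^j with i, j < n span all powers of z as functions of p; since z is
   injective, the first N of these are independent (Vandermonde). *)
Lemma card_common_zeros_le (n N : nat) (z w : 'I_N -> K) (c d c' d' : nat -> K) :
    injective z ->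
    (forall p, z p ^+ n = \sum_(l < n) (c l * z p ^+ l + d l * w p ^+ l)) ->
    (forall p, w p ^+ n = \sum_(l < n) (c' l * z p ^+ l + d' l * w p ^+ l)) ->
  (N <= n ^ 2)%N.
Proof.
move=> z_inj zn wn.
pose mon i j : 'rV[K]_N := \row_p (z p ^+ i * w p ^+ j).
pose B := (\sum_(ij : 'I_n * 'I_n) <<mon ij.1 ij.2>>)%MS.
have rB : (\rank B <= n ^ 2)%N.
  apply: leq_trans (mxrank_sum_leqif _) _ => /=.
  apply: (@leq_trans (\sum_(ij : 'I_n * 'I_n) 1)%N).
    by apply: leq_sum => ij _; rewrite mxrank_gen rank_leq_row.
  by rewrite sum1_card card_prod card_ord mulnn.
have monB i j : (mon i j <= B)%MS.
  have [t] := ubnP (i + j)%N; elim: t i j => // t IH i j ltij.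
  have [le_ni | lt_in] := leqP n i.
    have -> : mon i j =
        \sum_(l < n) (c l *: mon (l + (i - n))%N j + d l *: mon (i - n)%N (l + j)%N).
      apply/rowP=> p; rewrite summxE mxE -{1}(subnKC le_ni) exprD zn !mulr_suml.
      by apply: eq_bigr => l _; rewrite !mxE !exprD; ring.
    by apply: summx_sub => l _; have := ltn_ord l => ltl; apply: addmx_sub; apply: scalemx_sub; apply: IH; lia.
  have [le_nj | lt_jn] := leqP n j.
    have -> : mon i j =
        \sum_(l < n) (c' l *: mon (l + i)%N (j - n)%N + d' l *: mon i (l + (j - n))%N).
      apply/rowP=> p; rewrite summxE mxE -{1}(subnKC le_nj) exprD wn mulr_suml mulr_sumr.
      by apply: eq_bigr => l _; rewrite !mxE !exprD; ring.
    by apply: summx_sub => l _; have := ltn_ord l => ltl; apply: addmx_sub; apply: scalemx_sub; apply: IH; lia.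
  by apply: (sumsmx_sup (Ordinal lt_in, Ordinal lt_jn)); rewrite // genmxE.
pose V := Vandermonde N (\row_p z p).
have VB : (V <= B)%MS.
  apply/row_subP=> i; suff -> : row i V = mon i 0%N by [].
  by apply/rowP=> p; rewrite !mxE mulr1.
have uV : V \in unitmx.
  rewrite unitmxE det_Vandermonde unitfE; apply/prodf_neq0 => i _.
  apply/prodf_neq0 => j ltij; rewrite !mxE subr_eq0.
  by apply: contraTneq ltij => /z_inj ->; rewrite ltnn.
by rewrite -(mxrank_unit uV) (leq_trans (mxrankS VB)).
Qed.

End PointCount.

Section HarmonicZeros.
Variable R : realType.
(* Otherwise ^* denotes Num.conj or conjc depending on the scope of the argument. *)
Local Notation "x ^*" := (conjc x) : ring_scope.
Implicit Types (x y z : R[i]).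

(** * Conjugation and modulus in [R[i]] *)

Lemma conjcD x y : (x + y)^* = x^* + y^*.
Proof. exact: rmorphD. Qed.

Lemma conjcB x y : (x - y)^* = x^* - y^*.
Proof. exact: rmorphB. Qed.

Lemma conjcM x y : (x * y)^* = x^* * y^*.
Proof. exact: rmorphM. Qed.

Lemma conjcX x k : (x ^+ k)^* = x^* ^+ k.
Proof. exact: rmorphXn. Qed.

Lemma normcD_le x y : normc (x + y) <= normc x + normc y.
Proof. exact: le_normcD. Qed.

Lemma normcN x : normc (- x) = normc x.
Proof. by case: x => a b; rewrite /= !sqrrN. Qed.

Lemma normcB_le x y : normc (x - y) <= normc x + normc y.
Proof. by rewrite -(normcN y) normcD_le. Qed.

Lemma normc_ge0 x : 0 <= normc x.
Proof. by case: x => a b; rewrite /= sqrtr_ge0. Qed.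

Lemma normcJ x : normc x^* = normc x.
Proof. by case: x => a b; rewrite /= sqrrN. Qed.

Lemma normcX x k : normc (x ^+ k) = normc x ^+ k.
Proof. by elim: k => [|k IH]; rewrite ?expr0 ?normc1 // !exprS normcM IH. Qed.

Lemma normcR (r : R) : normc r%:C = `|r|.
Proof. by rewrite /= expr0n addr0 sqrtr_sqr. Qed.

Lemma normc_nat k : normc (k%:R : R[i]) = k%:R.
Proof.
by rewrite -(rmorph_nat (real_complex R)) normcR ger0_norm.
Qed.

Lemma ler_normc_sum I (s : seq I) (P : pred I) (F : I -> R[i]) :
  normc (\sum_(i <- s | P i) F i) <= \sum_(i <- s | P i) normc (F i).
Proof.
elim/big_ind2: _ => [|x r y t hx hy|//]; first by rewrite normc0.
exact: le_trans (normcD_le _ _) (lerD hx hy).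
Qed.

Lemma Re_le_normc x : `|complex.Re x| <= normc x.
Proof. by case: x => a b /=; rewrite -sqrtr_sqr ler_wsqrtr // lerDl sqr_ge0. Qed.

Lemma Im_le_normc x : `|complex.Im x| <= normc x.
Proof. by case: x => a b /=; rewrite -sqrtr_sqr ler_wsqrtr // lerDr sqr_ge0. Qed.

Lemma normc_le_ReIm x : normc x <= `|complex.Re x| + `|complex.Im x|.
Proof.
case: x => a b /=; rewrite -(@ger0_norm _ (`|a| + `|b|)) ?addr_ge0 //.
rewrite -sqrtr_sqr ler_wsqrtr // sqrrD !real_normK ?num_real //.
by rewrite addrAC lerDl mulrn_wge0 // mulr_ge0.
Qed.

(** * Contraction principle on a disc of the complex plane *)

Lemma contraction_fixpoint (T : R[i] -> R[i]) (r : R) :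
  0 <= r ->
  (forall x y, normc x <= r -> normc y <= r ->
     normc (T x - T y) <= normc (x - y) / 4) ->
  normc (T 0) <= r / 4 ->
  exists2 x, normc x <= r & T x = x.
Proof.
move=> r0 lipT T0.
(* Banach's theorem is applied in R^2 with the sup norm. It is at most the modulus, which is at most
   twice it, so the Lipschitz constant 1/4 becomes 1/2. *)
pose toC (v : 'rV[R]_2) : R[i] := v 0 0 +i* v 0 1.
pose ofC (z : R[i]) : 'rV[R]_2 := \row_j (if j == 0 then complex.Re z else complex.Im z).
have ofCK z : toC (ofC z) = z by case: z => a b; rewrite /toC !mxE.
have ofCB y z : ofC y - ofC z = ofC (y - z).
  by case: y z => [a b] [c d]; apply/rowP => j; rewrite !mxE; case: (j == 0).
have toCB v w : toC (v - w) = toC v - toC w by rewrite /toC !mxE.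
have norm_ofC z : `|ofC z| <= normc z.
  rewrite [leLHS]/Num.norm /= mx_normrE; apply/bigmax_leP; split=> [|[i j] _]; first exact: normc_ge0.
  by rewrite mxE /=; case: ifP => _; rewrite ?Re_le_normc ?Im_le_normc.
have coord_le (v : 'rV[R]_2) (j : 'I_2) : `|v 0 j| <= `|v|.
  by rewrite [leRHS]/Num.norm /= mx_normrE; apply: (le_bigmax _ (fun ij => `|v ij.1 ij.2|) (0, j)).
have norm_toC v : normc (toC v) <= 2 * `|v|.
  apply: le_trans (normc_le_ReIm _) _.
  by have /= := lerD (coord_le v 0) (coord_le v 1); lra.
(* Sup norm at most r/2 forces modulus at most r. The ball is stable because r/4 + r/4 = r/2. *)
pose U := closed_ball_ (fun v : 'rV[R]_2 => `|v|) 0 (r / 2).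
have UE v : U v -> normc (toC v) <= r.
  rewrite /U /closed_ball_ /= sub0r normrN => h.
  by apply: le_trans (norm_toC v) _; lra.
pose f v := ofC (T (toC v)).
have lipf v w : U v -> U w -> `|f v - f w| <= 2^-1 * `|v - w|.
  move=> /UE hv /UE hw; rewrite /f ofCB.
  apply: le_trans (norm_ofC _) _; apply: le_trans (lipT _ _ hv hw) _.
  by rewrite -toCB; have := norm_toC (v - w); lra.
have fU : set_fun U U f.
  move=> v /UE hv; rewrite /U /closed_ball_ /= sub0r normrN.
  apply: le_trans (norm_ofC _) _.
  have h0 : normc (0 : R[i]) <= r by rewrite normc0.
  have := lipT _ _ hv h0; have := normcD_le (T (toC v) - T 0) (T 0).
  by rewrite subrK subr0; lra.
pose mf := isFun.Build _ _ U U f fU.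
pose F : {fun U >-> U} := HB.pack f mf.
have q0 : (0 : R) <= 2^-1 by rewrite invr_ge0.
have ctr : is_contraction F.
  exists (NngNum q0); split=> /=; first lra.
  by move=> [v w] [/= hv hw]; apply: lipf.
have [||p Up pE] := banach_fixed_point ctr.
- exact: closed_closed_ball_.
- by exists 0; rewrite /U /closed_ball_ /= subr0 normr0 divr_ge0.
- by exists (toC p); [exact: UE | rewrite {2}pE /= /f ofCK].
Qed.


(** * Powers near 1, and persistence of a zero there under perturbation *)

Let rem k x : R[i] := (1 + x) ^+ k - 1 - k%:R * x.

(** The remainder is of second order, so its Lipschitz constant on a disc shrinks with the radius.
    Induction uses [rem k.+1 x = (1 + x) * rem k x + k * x^2]; the three resulting terms contribute
    2, 1 and 1 times 4^k r. *)
Lemma binomial_remainder_lipschitz k (r : R) x y :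
    0 <= r <= 1 -> normc x <= r -> normc y <= r ->
  normc (rem k x - rem k y) <= 4 ^+ k * r * normc (x - y).
Proof.
move=> /andP[r0 r1]; elim: k x y => [|k IH] x y hx hy.
  have r0' z : rem 0 z = 0 by rewrite /rem expr0 mul0r subrr subr0.
  by rewrite !r0' subrr normc0 !mulr_ge0 ?normc_ge0 ?exprn_ge0.
have rem0 : rem k 0 = 0 by rewrite /rem addr0 expr1n mulr0 subrr subr0.
have -> : rem k.+1 x - rem k.+1 y =
    (1 + x) * (rem k x - rem k y) + rem k y * (x - y) + k%:R * (x + y) * (x - y).
  by rewrite /rem !exprS -addn1 natrD; ring.
have hy0 : normc (rem k y) <= 4 ^+ k * r.
  have h0 : normc (0 : R[i]) <= r by rewrite normc0.
  have := IH y 0 hy h0; rewrite rem0 !subr0 => /le_trans; apply.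
  by rewrite ler_piMr ?mulr_ge0 ?exprn_ge0 // (le_trans hy).
have hx1 : normc (1 + x) <= 2.
  by have := normcD_le 1 x; rewrite normc1; lra.
have hxy : normc (x + y) <= 2 * r by have := normcD_le x y; lra.
have k4 : 2 * k%:R <= 4 ^+ k :> R.
  by rewrite -natrX -natrM ler_nat; elim: k {IH rem0 hy0} => // k; rewrite expnS; lia.
have d0 := normc_ge0 (x - y).
apply: le_trans (normcD_le _ _) _.
apply: le_trans (lerD (normcD_le _ _) (lexx _)) _.
rewrite !normcM normc_nat.
have h1 := ler_pM (normc_ge0 _) (normc_ge0 _) hx1 (IH x y hx hy).
have h2 := ler_wpM2r d0 hy0.
have h3 : k%:R * normc (x + y) * normc (x - y) <= 4 ^+ k * r * normc (x - y).
  apply: ler_wpM2r => //; apply: le_trans (ler_wpM2l _ hxy) _ => //.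
  by rewrite mulrA ler_wpM2r // mulrC.
by rewrite exprS; lra.
Qed.

Lemma pow_lipschitz k x y :
    normc x <= 1 -> normc y <= 1 ->
  normc ((1 + x) ^+ k - (1 + y) ^+ k) <= 2 * 4 ^+ k * normc (x - y).
Proof.
move=> hx hy.
have := @binomial_remainder_lipschitz k 1 x y.
rewrite ler01 lexx mulr1 => /(_ isT hx hy).
have -> : (1 + x) ^+ k - (1 + y) ^+ k = rem k x - rem k y + k%:R * (x - y).
  by rewrite /rem; ring.
have := normcD_le (rem k x - rem k y) (k%:R * (x - y)).
rewrite normcM normc_nat.
have k4 : k%:R <= 4 ^+ k :> R.
  by rewrite -natrX ler_nat; elim: k => // k; rewrite expnS; lia.
have := ler_wpM2r (normc_ge0 (x - y)) k4; lra.
Qed.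

(* The derivative of u^k - conj(u)^k.+1 at u = 1 is h |-> k h - (k+1) conj h,
   whose inverse g |-> - (k g + (k+1) conj g) / (2k+1) has norm at most 1: a
   zero of the perturbation is a fixed point of a contraction. *)
Lemma zero_near_one k n (r : R) : 0 < r ->
  exists2 e : R, 0 < e & forall b c : nat -> R[i],
    (forall j, (j < n)%N -> normc (b j) <= e /\ normc (c j) <= e) ->
  exists2 u, normc (u - 1) <= r &
    u ^+ k - u^* ^+ k.+1 + \sum_(j < n) (b j * u ^+ j + c j * u^* ^+ j) = 0.
Proof.
(* The bound 40 * 4^k * s <= 1 makes the Lipschitz constants of [rem k] and [rem k.+1], 5 * 4^k * s
   together, at most 1/8. *)
move=> r_gt0; pose s : R := Num.min r (40 * 4 ^+ k)^-1.
have p40 : 1 <= 4 ^+ k :> R by rewrite exprn_ege1 // ler1n.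
have s_gt0 : 0 < s by rewrite lt_min r_gt0 invr_gt0 mulr_gt0 // exprn_gt0.
have sr : s <= r by rewrite ge_min lexx.
have s40 : 40 * 4 ^+ k * s <= 1.
  rewrite -ler_pdivlMl ?mulr1; first by rewrite ge_min lexx orbT.
  by rewrite mulr_gt0 // exprn_gt0.
have s1 : s <= 1 by have := ler_wpM2r (ltW s_gt0) p40; lra.
pose S : R := \sum_(j < n) 2 * 4 ^+ j.
have S_ge0 : 0 <= S by apply: sumr_ge0 => j _; rewrite mulr_ge0 ?exprn_ge0.
have D_gt0 : 0 < 16 * (S + n%:R + 1) by have := ler0n R n; lra.
(* With this [e] the perturbation has Lipschitz constant 2 e S <= 1/8 and value at most 2 e n <= s/4
   at u = 1. *)
pose e := s / (16 * (S + n%:R + 1)).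
have e_gt0 : 0 < e by rewrite divr_gt0.
have eD : e * (16 * (S + n%:R + 1)) = s by rewrite divfK // gt_eqF.
have eS : 0 <= e * S by rewrite mulr_ge0 // ltW.
have en : 0 <= e * n%:R by rewrite mulr_ge0 // ltW.
exists e => // b c bc.
(* At u = 1 + x the equation reads k x - (k+1) conj x + [N x] = 0, the constants 1 and -1
   cancelling. *)
pose N x : R[i] := rem k x - (rem k.+1 x)^* +
  \sum_(j < n) (b j * (1 + x) ^+ j + c j * (1 + x)^* ^+ j).
have NB x y : normc x <= s -> normc y <= s ->
    normc (N x - N y) <= normc (x - y) / 4.
  move=> hx hy; have s01 : 0 <= s <= 1 by rewrite ltW.
  have -> : N x - N y = (rem k x - rem k y) - (rem k.+1 x - rem k.+1 y)^* +
      \sum_(j < n) (b j * ((1 + x) ^+ j - (1 + y) ^+ j) +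
                    c j * ((1 + x) ^+ j - (1 + y) ^+ j)^*).
    transitivity (rem k x - rem k y - (rem k.+1 x - rem k.+1 y)^* +
      (\sum_(j < n) (b j * (1 + x) ^+ j + c j * (1 + x)^* ^+ j) -
       \sum_(j < n) (b j * (1 + y) ^+ j + c j * (1 + y)^* ^+ j))).
      rewrite /N conjcB.
      move: (rem k x) (rem k y) (rem k.+1 x)^* (rem k.+1 y)^* => A B C D; ring.
    by rewrite -sumrB; congr (_ + _); apply: eq_bigr => j _; rewrite conjcB !conjcX; ring.
  apply: le_trans (normcD_le _ _) _.
  apply: le_trans (lerD (normcB_le _ _) (ler_normc_sum _ _ _)) _.
  rewrite normcJ.
  have d0 := normc_ge0 (x - y).
  have h1 := binomial_remainder_lipschitz k s01 hx hy.
  have h2 := binomial_remainder_lipschitz k.+1 s01 hx hy.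
  have h3 : \sum_(j < n) normc (b j * ((1 + x) ^+ j - (1 + y) ^+ j) +
      c j * ((1 + x) ^+ j - (1 + y) ^+ j)^*) <= 2 * (e * S) * normc (x - y).
    rewrite /S !mulr_sumr mulr_suml; apply: ler_sum => j _.
    have [hb hc] := bc j (ltn_ord j).
    apply: le_trans (normcD_le _ _) _; rewrite !normcM normcJ.
    have hp := pow_lipschitz j (le_trans hx s1) (le_trans hy s1).
    have := ler_pM (normc_ge0 _) (normc_ge0 _) hb hp.
    by have := ler_pM (normc_ge0 _) (normc_ge0 _) hc hp; lra.
  have h4 : 5 * 4 ^+ k * s * normc (x - y) <= 8^-1 * normc (x - y).
    by apply: ler_wpM2r => //; lra.
  have h5 : 2 * (e * S) * normc (x - y) <= 8^-1 * normc (x - y).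
    by apply: ler_wpM2r => //; lra.
  by move: h2; rewrite exprS; lra.
have N0 : normc (N 0) <= s / 4.
  have rem0 j : rem j 0 = 0 by rewrite /rem addr0 expr1n mulr0 subrr subr0.
  rewrite /N !rem0 conjc0 subrr add0r.
  apply: le_trans (ler_normc_sum _ _ _) _.
  apply: (@le_trans _ _ (\sum_(j < n) (2 * e))).
    apply: ler_sum => j _; have [hb hc] := bc j (ltn_ord j).
    rewrite addr0 conjc1 !expr1n !mulr1.
    by have := normcD_le (b j) (c j); lra.
  by rewrite sumr_const card_ord -mulr_natr; lra.
pose T x : R[i] := (k%:R * N x + k.+1%:R * (N x)^*) / (2 * k + 1)%:R.
have m_gt0 : 0 < (2 * k + 1)%:R :> R by rewrite ltr0n addn1.
have LE (g : R[i]) : normc ((k%:R * g + k.+1%:R * g^*) / (2 * k + 1)%:R) <= normc g.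
  rewrite normcM normcV.
  rewrite normc_nat ler_pdivrMr //.
  apply: le_trans (normcD_le _ _) _; rewrite !normcM !normc_nat normcJ.
  by rewrite -mulrDl mulrC -natrD addnS -addn1 addnn mul2n.
have [|||x hx Tx] := @contraction_fixpoint T s.
- exact: ltW.
- move=> x y hx hy; apply: le_trans (NB x y hx hy).
  suff -> : T x - T y = (k%:R * (N x - N y) + k.+1%:R * (N x - N y)^*) / (2 * k + 1)%:R.
    exact: LE.
  by rewrite /T conjcB; ring.
- exact: le_trans (LE _) N0.
exists (1 + x); first by rewrite addrC addKr (le_trans hx).
have -> : (1 + x) ^+ k - (1 + x)^* ^+ k.+1 +
    \sum_(j < n) (b j * (1 + x) ^+ j + c j * (1 + x)^* ^+ j) =
    k%:R * x - k.+1%:R * x^* + N x.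
  rewrite /N /rem.
  move: (\sum_(j < n) _) => S'.
  rewrite !conjcB conjcX conjcM conjc_nat conjc1; ring.
have mC : (2 * k + 1)%:R != 0 :> R[i] by rewrite pnatr_eq0 addn1.
have xE : (2 * k + 1)%:R * x = k%:R * N x + k.+1%:R * (N x)^*.
  by rewrite -{1}Tx mulrC divfK.
have xJ : (2 * k + 1)%:R * x^* = k%:R * (N x)^* + k.+1%:R * N x.
  move/(congr1 (@conjc R)): xE.
  by rewrite conjcD !conjcM !conjc_nat conjcK.
apply: (mulfI mC); rewrite mulr0.
transitivity (k%:R * ((2 * k + 1)%:R * x) - k.+1%:R * ((2 * k + 1)%:R * x^*)
  + (2 * k + 1)%:R * N x); first by ring.
by rewrite xE xJ; ring.
Qed.

(** * The harmonic polynomial as a single sum over the degree *)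

Definition altpow (j : nat) z : R[i] := if odd j then z^* ^+ j else z ^+ j.

Lemma altpowM j x y : altpow j (x * y) = altpow j x * altpow j y.
Proof. by rewrite /altpow conjcM !exprMn; case: odd. Qed.

Lemma altpow_real j (e : R) : altpow j e%:C = (e ^+ j)%:C.
Proof. by rewrite /altpow conjc_real if_same rmorphXn. Qed.

Lemma normc_altpow j z : normc (altpow j z) = normc z ^+ j.
Proof. by rewrite /altpow; case: odd; rewrite normcX ?normcJ. Qed.

Lemma altpow_neq0 j z : z != 0 -> altpow j z != 0.
Proof. by move=> z0; rewrite /altpow; case: odd; rewrite expf_neq0 ?conjc_eq0. Qed.

Lemma PnE n (a : nat -> R[i]) z :
  a 0%N = 0 -> Pn n a z = \sum_(j < n.+1) a j * altpow j z.
Proof.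
move=> a0; elim: n => [|n IH].
  by rewrite /Pn !big_geq // addr0 big_ord1 a0 mul0r.
rewrite big_ord_recr /= -IH /Pn /altpow /=.
(* Degree n+1 joins the sum in z when n is odd and the sum in conj z when n is even. *)
have := odd_double_half n; rewrite uphalf_half; case: (odd n) => /= nE.
  rewrite [X in X + _](@big_nat_recr _ _ _ n./2.+1) //= addrAC.
  by have -> : n.+1 = (2 * n./2.+1)%N by lia.
rewrite add0n [X in _ + X](@big_nat_recr _ _ _ n./2.+1) //= addrA.
by have -> : n.+1 = (2 * n./2.+1).-1 by lia.
Qed.

(** * Roots of unity, their separation, and the exponents of e *)

Lemma unity_roots_enum m : (0 < m)%N ->
  exists2 w : 'I_m -> R[i], injective w & forall i, w i ^+ m = 1.
Proof.
move=> m_gt0; have [r] := closed_field_poly_normal ('X^m - 1 : {poly R[i]}).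
rewrite (monicP (monic_Xn_sub_1 _ m_gt0)) scale1r => rE.
have sz : size r = m.
  by apply: succn_inj; rewrite -(size_Xn_sub_1 R[i] m_gt0) rE size_prod_XsubC.
have ur : uniq r.
  rewrite -separable_prod_XsubC -rE separable_Xn_sub_1 // pnatr_eq0 -lt0n //.
exists (fun i => nth 0 r i) => [i j /eqP|i].
  by rewrite nth_uniq ?sz // => /eqP/val_inj.
have : root ('X^m - 1) (nth 0 r i) by rewrite rE root_prod_XsubC mem_nth ?sz.
by rewrite rootE !hornerE subr_eq0 => /eqP.
Qed.

Lemma separation (I : finType) (f : I -> R[i]) : injective f ->
  exists2 r : R, 0 < r & forall i j, normc (f i - f j) < r -> i = j.
Proof.
move=> f_inj.
(* The value 1 is the default when there is no pair of distinct indices. *)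
exists (\big[Num.min/1]_(p : I * I | p.1 != p.2) normc (f p.1 - f p.2)).
  apply/bigmin_gtP; split=> // p; rewrite lt_neqAle normc_ge0 andbT.
  apply: contraNneq => h; apply/eqP/f_inj/eqP; rewrite -subr_eq0.
  by apply/eqP/eq0_normc.
move=> i j; apply: contraTeq => ij; rewrite -leNgt.
exact: (bigmin_le_cond _ (fun p => normc (f p.1 - f p.2)) (j := (i, j))).
Qed.

(** At z = e^-k w the term of degree j carries e^('C(j,2) - k j). Multiplied by e^'C(k+1,2), its
    exponent is (j-k)(j-k-1)/2, which vanishes exactly at j = k and j = k+1. The case split keeps
    the natural subtractions exact. *)
Lemma binomial2_shift j k : ('C(j, 2) + 'C(k.+1, 2) =
  k * j + (if k <= j then 'C(j - k, 2) else 'C(k.+1 - j, 2)))%N.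
Proof.
have C2 i : (2 * 'C(i, 2) + i = i * i)%N.
  by elim: i => // i IH; rewrite binS bin1; nia.
case: leqP => [/subnKC <-|/ltnW/subnKC <-].
  set d := (j - k)%N; rewrite addKn.
  by have := C2 (k + d)%N; have := C2 k.+1; have := C2 d; nia.
set d := (k - j)%N; rewrite -addnS addKn.
by have := C2 j; have := C2 (j + d.+1)%N; have := C2 d.+1; nia.
Qed.

(* a_0 = 0 only serves to let the sum in PnE start at 0. *)
Definition acoef (e : R) (j : nat) : R[i] :=
  if j == 0%N then 0 else (-1) ^+ j * (e ^+ 'C(j, 2))%:C.

(** * The 2k+1 zeros of modulus about e^-k *)

Lemma zeros_at_scale k n : (0 < k < n)%N ->
  exists2 e0 : R, 0 < e0 & forall e, 0 < e <= e0 ->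
  exists t : seq R[i], [/\ uniq t, size t = (2 * k + 1)%N &
    forall z, z \in t ->
      3 / 4 <= normc z * e ^+ k <= 5 / 4 /\ Pn n (acoef e) z = 0].
Proof.
move=> /andP[k_gt0 ltkn].
have [w w_inj wm] := @unity_roots_enum (2 * k + 1) (ltn_addl _ (ltn0Sn 0)).
have [r' r'_gt0 sep] := separation w_inj.
(* The bound 1/4 confines |v| to [3/4, 5/4]; the bound r'/4 keeps the points w_i v_i distinct. *)
pose r := Num.min (r' / 4) 4^-1.
have r_gt0 : 0 < r by rewrite lt_min divr_gt0 // invr_gt0 ltr0n.
have r4 : r <= 4^-1 by rewrite ge_min lexx orbT.
have rr' : r <= r' / 4 by rewrite ge_min lexx.
have normw i : normc (w i) = 1.
  have /eqP := congr1 (@normc R) (wm i); rewrite normcX normc1.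
  by rewrite pexpr_eq1 ?normc_ge0 ?addn1 // => /eqP.
have w0 i : w i != 0.
  by apply: contraTneq (oner_neq0 R) => wi; rewrite -(normw i) wi normc0 eqxx.
have [e0 e0_gt0 near1] := @zero_near_one k n.+1 r r_gt0.
exists (Num.min e0 2^-1) => [|e]; first by rewrite lt_min e0_gt0 invr_gt0 ltr0n.
rewrite le_min => /and3P[e_gt0 ee0 e2].
have e1 : e <= 1 by lra.
pose D j := if (k <= j)%N then 'C(j - k, 2) else 'C(k.+1 - j, 2).
(* Normalised coefficient of degree j at z = e^-k w_i v. Degrees k and k+1 are left out as the main
   terms, degree 0 because a_0 = 0. *)
pose be i j : R[i] := if (j == 0%N) || (j == k) || (j == k.+1) then 0 else
  (-1) ^+ (j + k) * (e ^+ D j)%:C * (altpow j (w i) / altpow k (w i)).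
have be_le i j : normc (be i j) <= e0.
  rewrite /be; case: ifP => [_|/negbT]; first by rewrite normc0 ltW.
  rewrite !negb_or => /andP[/andP[j0 jk] jk1].
  rewrite !normcM normcV !normc_altpow normw !expr1n invr1 !mulr1.
  rewrite normcX normcN normc1 expr1n mul1r normcR ger0_norm ?exprn_ge0 ?(ltW e_gt0) //.
  (* A positive exponent gives e^(D j) <= e <= e0. *)
  have D_gt0 : (0 < D j)%N by rewrite /D; case: (leqP k j) => h; rewrite bin_gt0; lia.
  apply: (le_trans _ ee0); rewrite -(prednK D_gt0) exprS ler_piMr ?(ltW e_gt0) //.
  by rewrite exprn_ile1 // (ltW e_gt0).
have zero i : exists2 v, normc (v - 1) <= r &
    altpow k v - altpow k.+1 v + \sum_(j < n.+1) be i j * altpow j v = 0.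
  (* For odd k the equation is read in u = conj v. Degrees of the parity of k then become powers of
     u, the others powers of conj u. *)
  pose b j := if odd j == odd k then be i j else 0.
  pose c j := if odd j == odd k then 0 else be i j.
  have [j _|u hu uE] := near1 b c.
    by rewrite /b /c; case: ifP; rewrite normc0 be_le ltW.
  exists (if odd k then u^* else u).
    by case: ifP => // _; rewrite -normcJ conjcB conjcK conjc1.
  apply: etrans uE; rewrite /altpow /=; congr (_ - _ + _).
  - by case: (odd k); rewrite ?conjcK.
  - by case: (odd k); rewrite /= ?conjcK.
  apply: eq_bigr => j _; rewrite /b /c.
  by case: (odd k); case: (odd j); rewrite /= ?conjcK mul0r ?addr0 ?add0r.
have [v vr vE] := fin_all_exists2 zero.
have normv i : 3 / 4 <= normc (v i) <= 5 / 4.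
  have := normcD_le (v i - 1) 1; have := normcB_le (v i) (v i - 1).
  by rewrite subrK opprB addrC subrK normc1 => h1 h2; have := vr i; lra.
pose z i := (e ^- k)%:C * (w i * v i).
have ek0 : (e ^- k)%:C != 0.
  by rewrite (fmorph_eq0 (real_complex R)) invr_eq0 expf_neq0 // gt_eqF.
have z_inj : injective z.
  move=> i j /(mulfI ek0) ij; apply: sep.
  have -> : w i - w j = w j * (v j - 1) - w i * (v i - 1).
    by rewrite !mulrBr ij; ring.
  apply: le_lt_trans (normcB_le _ _) _; rewrite !normcM !normw !mul1r.
  by have := vr i; have := vr j; lra.
exists [seq z i | i <- enum 'I_(2 * k + 1)]; split.
- by rewrite map_inj_uniq ?enum_uniq.
- by rewrite size_map size_enum_ord.
move=> _ /mapP[i _ ->]; split.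
  rewrite !normcM normcR normw mul1r ger0_norm ?invr_ge0 ?exprn_ge0 ?(ltW e_gt0) //.
  by rewrite mulrAC mulVf ?mul1r ?normv // expf_neq0 // gt_eqF.
rewrite PnE //.
(* This factor brings the coefficients of degrees k and k+1 to 1 and -1. *)
have fac0 : (-1) ^+ k * (e ^+ 'C(k.+1, 2))%:C / altpow k (w i) != 0.
  rewrite !mulf_neq0 ?invr_eq0 ?signr_eq0 ?altpow_neq0 //.
  by rewrite (fmorph_eq0 (real_complex R)) expf_neq0 // gt_eqF.
apply: (mulfI fac0); rewrite mulr0 mulr_sumr; apply: etrans (vE i).
(* Writing the main terms with Kronecker deltas lets the two sums be compared degree by degree. *)
have delta (l : nat) : (l < n.+1)%N ->
    altpow l (v i) = \sum_(j < n.+1) (j == l :> nat)%:R * altpow j (v i).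
  move=> ltl; rewrite (bigD1 (Ordinal ltl)) //= eqxx mul1r big1 ?addr0 // => j jl.
  by rewrite (_ : _ == _ = false) ?mul0r //; apply: negbTE.
rewrite (delta k) ?(delta k.+1) ?(leqW ltkn) // -sumrB -big_split /=.
apply: eq_bigr => j _; rewrite -mulrBl -mulrDl /z !altpowM altpow_real.
rewrite !mulrA; congr (_ * _).
have D0 : (-1) ^+ k * (e ^+ 'C(k.+1, 2))%:C / altpow k (w i) *
    ((-1) ^+ j * (e ^+ 'C(j, 2))%:C) * (e ^- k ^+ j)%:C * altpow j (w i) =
    (-1) ^+ (j + k) * (e ^+ D j)%:C * (altpow j (w i) / altpow k (w i)).
  have -> : e ^+ D j = e ^+ 'C(k.+1, 2) * e ^+ 'C(j, 2) * e ^- k ^+ j.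
    rewrite -exprD addnC binomial2_shift exprD exprM exprVn mulrAC mulfV ?mul1r //.
    by rewrite !expf_neq0 // gt_eqF.
  by rewrite !rmorphM exprD /=; ring.
rewrite /acoef /be; case: (eqVneq (j : nat) 0%N) => [j0|j0] /=.
  by rewrite j0 mulr0 !mul0r addr0 (ltn_eqF k_gt0) subrr.
have wk : altpow k (w i) / altpow k (w i) = 1 by rewrite divff ?altpow_neq0.
rewrite D0; case: (eqVneq (j : nat) k) => [jk|jk] /=.
  rewrite jk (ltn_eqF (ltnSn k)) subr0 addr0 wk mulr1.
  by rewrite /D leqnn subnn /= mulr1 -signr_odd addnn odd_double.
case: (eqVneq (j : nat) k.+1) => [jk1|jk1] /=; last by rewrite subrr add0r.
(* Since |w| = 1, conj w is the inverse of w, and w^(2k+1) = 1 gives the equality for either parity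
   of k. *)
have wk1 : altpow k.+1 (w i) = altpow k (w i).
  have wJ : (w i)^* * w i = 1.
    by rewrite mulrC -sqr_normc -[`|_|]/(normc (w i))%:C normw expr1n.
  have wkk : w i ^+ k.+1 * w i ^+ k = 1.
    by rewrite -exprD -(wm i); congr (_ ^+ _); lia.
  rewrite /altpow /=; case: (odd k) => /=.
    by apply: (mulIf (expf_neq0 k (w0 i))); rewrite wkk -exprMn wJ expr1n.
  apply: (mulIf (expf_neq0 k.+1 (w0 i))).
  by rewrite -exprMn wJ expr1n mulrC wkk.
rewrite jk1 wk1 wk addr0 sub0r mulr1 /D leqnSn subSnn /= mulr1.
by rewrite -signr_odd oddD /= addNb addbb expr1.
Qed.

(** * Collecting the zeros of all scales, and the upper bound *)

Lemma exists_many_zeros n k : (k < n)%N ->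
  exists2 e0 : R, 0 < e0 & forall e, 0 < e <= e0 ->
  exists s : seq R[i], [/\ uniq s, size s = (k.+1 ^ 2)%N &
    forall z, z \in s -> normc z * e ^+ k <= 5 / 4 /\ Pn n (acoef e) z = 0].
Proof.
elim: k => [|k IH] ltkn.
  exists 1 => // e _; exists [:: 0]; split=> // z; rewrite inE => /eqP ->.
  split; first by rewrite normc0 mul0r divr_ge0.
  rewrite PnE //; apply: big1 => j _; rewrite /acoef.
  case: eqVneq => [_|j0]; first by rewrite mul0r.
  by rewrite /altpow conjc0 if_same expr0n (negbTE j0) mulr0.
have [e1 e1_gt0 h1] := IH (ltnW ltkn).
have [e2 e2_gt0 h2] := @zeros_at_scale k.+1 n ltkn.
exists (Num.min 2^-1 (Num.min e1 e2)) => [|e].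
  by rewrite !lt_min invr_gt0 ltr0n e1_gt0.
rewrite !le_min => /and4P[e_gt0 eh ee1 ee2].
have [|s [us ss hs]] := h1 e; first by rewrite e_gt0.
have [|t [ut st ht]] := h2 e; first by rewrite e_gt0.
(* As e <= 1/2, earlier zeros satisfy |z| e^(k+1) <= 5/8 < 3/4, so they differ from those of the new
   scale. *)
have le_s z : z \in s -> normc z * e ^+ k.+1 <= 5 / 8.
  move=> /hs[zs _]; have z0 : 0 <= normc z * e ^+ k.
    by rewrite mulr_ge0 ?normc_ge0 ?exprn_ge0 // ltW.
  by rewrite exprSr mulrA; have := ler_pM z0 (ltW e_gt0) zs eh; lra.
exists (s ++ t); split.
- rewrite cat_uniq us ut andbT /=; apply/hasPn => z zt.
  apply/negP => /le_s; have [/andP[] ] := ht z zt; lra.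
- by rewrite size_cat ss st; lia.
move=> z; rewrite mem_cat => /orP[zs|zt].
  by split; [have := le_s z zs; lra | case: (hs z zs)].
by have [/andP[_ ?] ?] := ht z zt.
Qed.

(** Solving for the top term, possible as a_n is nonzero, gives z^n for even n and conj(z)^n for odd
    n; the conjugate equation gives the other. These are the two relations of
    [card_common_zeros_le]. *)
Lemma size_zeros_le n (a : nat -> R[i]) (s : seq R[i]) :
    a 0%N = 0 -> a n != 0 -> uniq s -> (forall z, z \in s -> Pn n a z = 0) ->
  (size s <= n ^ 2)%N.
Proof.
move=> a0 an us hs.
pose c l := if odd l then 0 else - (a l / a n).
pose d l := if odd l then - (a l / a n) else 0.
pose z (p : 'I_(size s)) := nth 0 s p.
have zn p : altpow n (z p) = \sum_(l < n) (c l * z p ^+ l + d l * (z p)^* ^+ l).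
  have /eqP := hs _ (mem_nth 0 (ltn_ord p)); rewrite PnE // big_ord_recr /=.
  rewrite addrC addr_eq0 => /eqP h; apply: (mulfI an); rewrite h mulr_sumr -sumrN.
  apply: eq_bigr => l _; rewrite /c /d /altpow.
  by case: (odd l); rewrite mul0r ?add0r ?addr0 mulrA mulrN mulrCA mulfV // mulr1 mulNr.
have znJ p : (altpow n (z p))^* =
    \sum_(l < n) ((d l)^* * z p ^+ l + (c l)^* * (z p)^* ^+ l).
  rewrite zn (raddf_sum (@conjc R)); apply: eq_bigr => l _.
  by rewrite /= conjcD !conjcM !conjcX conjcK addrC.
have z_inj : injective z.
  by move=> p q /eqP; rewrite /z nth_uniq // => /eqP/val_inj.
case nodd: (odd n); move: zn znJ; rewrite /altpow nodd => zn znJ.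
  apply: (card_common_zeros_le (w := fun p => (z p)^*) (c := fun l => (d l)^*)
    (d := fun l => (c l)^*) z_inj _ zn) => p.
  by rewrite -znJ conjcX conjcK.
apply: (card_common_zeros_le (w := fun p => (z p)^*) (c' := fun l => (d l)^*)
  (d' := fun l => (c l)^*) z_inj zn) => p.
by rewrite -znJ conjcX.
Qed.

End HarmonicZeros.

Theorem theorem4p1 (R : realType) (n : nat) (hn : (1 <= n)%N) :
  exists a : nat -> R[i],
    (forall j : nat, (1 <= j <= n)%N -> a j != 0) /\
    exists s : seq R[i],
      [/\ uniq s, size s = (n ^ 2)%N & forall z : R[i], Pn n a z = 0 <-> z \in s].
Proof.
case: n hn => // n _.
have [e e_gt0 /(_ e)[|s [us ss hs]]] := @exists_many_zeros R n.+1 n (ltnSn n).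
  by rewrite e_gt0 lexx.
have a_neq0 j : (0 < j)%N -> acoef e j != 0.
  move=> j_gt0; rewrite /acoef (gtn_eqF j_gt0) mulf_neq0 ?signr_eq0 //.
  by rewrite (fmorph_eq0 (real_complex R)) expf_neq0 // gt_eqF.
exists (acoef e); split=> [j /andP[j_gt0 _]|]; first exact: a_neq0.
exists s; split=> // z; split=> [zP|/hs[]//].
(* A zero outside [s] would give one more distinct zero than the upper bound allows. *)
apply: contraT => zs; have := @size_zeros_le R n.+1 (acoef e) (z :: s).
rewrite /= zs us ss ltnn; apply=> // [|y]; first exact: a_neq0.
by rewrite inE => /orP[/eqP ->|/hs[]].
Qed.
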